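(* There is a universal constant $c>0$ such that for every $K\ge2$, every integer $R\ge K$, and every integer mandatory budget $M\ge0$, there is a blockwise-fair problem instance (blocks, block lengths $H_b$, and integer floors $m_{b,i}$) with total mandatory exposure $\sum_{b,i}m_{b,i}=M$ and total residual budget $\sum_b(H_b-\sum_im_{b,i})=R$ on which every blockwise-fair policy $\pi$ suffers minimax fair regret $\Omega(\sqrt{KR})$: $$\sup_{\mu\in[0,1]^K}\mathrm{Reg}^\pi_{\mathbf m}(T)\ \ge\ c\sqrt{KR}.$$
   Context: Bandit: arm $i\in[K]$ produces independent rewards in $[0,1]$ with mean $\mu_i$ (i.i.d. within an arm); $\mu_\star=\max_i\mu_i$, $i^\star$ a best arm, $\Delta_i=\mu_\star-\mu_i$; $A_t$ is the arm pulled at round $t$. The supremum is over bandits of this kind with mean vector $\mu$. Blockwise floors: the horizon $T=\sum_bH_b$ is partitioned into consecutive blocks, block $b$ of length $H_b$ with floor vector $m_b\in\mathbb Z_{\ge0}^K$, $\sum_im_{b,i}\le H_b$. A policy is blockwise fair if $N_{b,i}\ge m_{b,i}$ for every block $b$ and arm $i$, where $N_{b,i}$ counts pulls of arm $i$ inside block $b$. $\mathrm{OPT}_{\mathbf m}(T)=T\mu_\star-\sum_b\sum_{i\ne i^\star}m_{b,i}\Delta_i$ and $\mathrm{Reg}^\pi_{\mathbf m}(T)=\mathrm{OPT}_{\mathbf m}(T)-\mathbb E_\pi[\sum_{t=1}^T\mu_{A_t}]$. *)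

(* Defs.v *)
From HB Require Import structures.
From mathcomp Require Import all_boot all_order all_algebra.
From mathcomp Require Import all_classical all_reals all_analysis.

Set Implicit Arguments.
Unset Strict Implicit.
Unset Printing Implicit Defensive.

Import Order.TTheory GRing.Theory Num.Theory.

Local Open Scope classical_set_scope.
Local Open Scope ring_scope.

Definition mutually_independent (R : realType) d (W : measurableType d)
    (P : probability W R) (I : finType) (X : I -> {RV P >-> R}) : Prop :=
  forall (J : {set I}) (B : I -> set (measurableTypeR R)),
    (forall i, measurable (B i)) ->
    P [set w | forall i, i \in J -> B i (X i w)] =
    (\prod_(i in J) P [set w | B i (X i w)])%E.

(* [reward t i] is the reward that arm [i] would yield if it were pulled in
   round [t]; rounds are numbered from 0, and the stochastic requirements bear
   on the [T] rounds that are actually played. *)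
Record bandit (R : realType) (K T : nat) (mu : 'I_K -> R) := Bandit {
  bd_disp : measure_display;
  bd_space : measurableType bd_disp;
  bd_law : probability bd_space R;
  reward : nat -> 'I_K -> {RV bd_law >-> R};
  reward_itv : forall t i w, 0 <= reward t i w <= 1;
  reward_mean : forall t i, (t < T)%N ->
    ('E_bd_law[reward t i] = (mu i)%:E)%E;
  reward_ident : forall s t i (B : set (measurableTypeR R)),
    (s < T)%N -> (t < T)%N -> measurable B ->
    distribution bd_law (reward s i) B = distribution bd_law (reward t i) B;
  reward_indep : mutually_independent
    (fun ti : 'I_T * 'I_K => reward ti.1 ti.2)
}.

(* The default value 0 is harmless: the means are nonnegative. *)
Definition mean_star (R : realType) K (mu : 'I_K -> R) : R :=
  \big[Num.max/0]_i mu i.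

Definition best_arm (R : realType) K (mu : 'I_K -> R) (i : 'I_K) : Prop :=
  mu i = mean_star mu.

Definition gap (R : realType) K (mu : 'I_K -> R) (i : 'I_K) : R :=
  mean_star mu - mu i.

Record instance (K : nat) := Instance {
  nblocks : nat;
  block_len : 'I_nblocks -> nat;
  floor_ : 'I_nblocks -> 'I_K -> nat;
  block_len_gt0 : forall b, (0 < block_len b)%N;
  floor_le : forall b, (\sum_i floor_ b i <= block_len b)%N
}.

Section instance_defs.
Variables (K : nat) (I : instance K).

Definition horizon : nat := (\sum_(b < nblocks I) block_len b)%N.

Definition block_start (b : 'I_(nblocks I)) : nat :=
  (\sum_(b' < nblocks I | (b' < b)%N) block_len b')%N.

Definition total_mandatory : nat :=
  (\sum_(b < nblocks I) \sum_(i < K) floor_ b i)%N.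

Definition total_residual : nat :=
  (\sum_(b < nblocks I) (block_len b - \sum_(i < K) floor_ b i))%N.

Definition opt (R : realType) (mu : 'I_K -> R) (istar : 'I_K) : R :=
  horizon%:R * mean_star mu -
  \sum_(b < nblocks I) \sum_(i < K | i != istar) (floor_ b i)%:R * gap mu i.

End instance_defs.

(* A randomized history-dependent policy: a random seed, independent of the
   rewards, is drawn once, and [act u h] is the arm pulled after the history
   [h] of (arm, observed reward) pairs, oldest first. *)
Record policy (R : realType) (K : nat) := Policy {
  seed_disp : measure_display;
  seed : measurableType seed_disp;
  seed_law : probability seed R;
  act : seed -> seq ('I_K * R) -> 'I_K;
  act_measurable : forall (t : nat) (a : t.-tuple 'I_K) (i : 'I_K),
    measurable [set ux : seed * t.-tuple (measurableTypeR R) |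
                 act ux.1 (zip a ux.2) = i]
}.

Section interaction.
Variables (R : realType) (K : nat).

Fixpoint history (f : seq ('I_K * R) -> 'I_K) (x : nat -> 'I_K -> R)
    (t : nat) : seq ('I_K * R) :=
  if t is s.+1 then
    let h := history f x s in rcons h (f h, x s (f h))
  else [::].

Variables (I : instance K) (pi : policy R K) (T : nat) (mu : 'I_K -> R).
Variable nu : bandit T mu.

Definition joint_law : probability (bd_space nu * seed pi)%type R :=
  (bd_law nu \x seed_law pi)%E.

Definition arm (t : nat) (w : bd_space nu * seed pi) : 'I_K :=
  let f := act w.2 in f (history f (fun s i => reward nu s i w.1) t).

Definition pulls (b : 'I_(nblocks I)) (i : 'I_K)
    (w : bd_space nu * seed pi) : nat :=
  (\sum_(block_start b <= t < block_start b + block_len b) (arm t w == i))%N.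

Definition regret (istar : 'I_K) : \bar R :=
  ((opt I mu istar)%:E
   - 'E_joint_law[fun w => (\sum_(0 <= t < horizon I) mu (arm t w))%R])%E.

End interaction.

(* The floors are required to hold almost surely under every bandit, which is
   the weakest reading: it is implied by their holding on every trajectory. *)
Definition blockwise_fair (R : realType) K (I : instance K)
    (pi : policy R K) : Prop :=
  forall (mu : 'I_K -> R) (nu : bandit (horizon I) mu),
    {ae joint_law pi nu, forall w, forall b i,
       (floor_ b i <= pulls (I := I) b i w)%N}.

Definition sup_regret (R : realType) K (I : instance K)
    (pi : policy R K) : \bar R :=
  ereal_sup [set r | exists (mu : 'I_K -> R) (nu : bandit (horizon I) mu)
                            (istar : 'I_K),
    [/\ forall i, 0 <= mu i <= 1, best_arm mu istar
      & r = regret I pi nu istar]].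

(* Main.v *)
Require Import Defs.
From HB Require Import structures.
From mathcomp Require Import all_boot all_order all_algebra.
From mathcomp Require Import all_classical all_reals all_analysis.
From mathcomp Require Import measurable_realfun ring lra.

(** The instance has one free block of [Rb] rounds followed by [M] blocks of
    length 1 whose single round is forced on a fixed arm.  The forced rounds
    contribute the same amount to the benchmark and to the reward, so the regret
    is that of an ordinary [Rb]-round bandit.  There, the means are 1/2 except
    for one arm [i] with mean 1/2 + e, and freezing the seed makes the policy
    deterministic.  Let [N] count the pulls of arm [i], let [L] be the
    likelihood ratio of the bumped bandit to the flat one, and let [s <= ln L]
    be additive along the history with flat mean [- 8 e^2 E N].  Then [L - 1]
    is at most [(257/32) (L + 1) - (255/16) (1 + s/2)], whose flat mean is
    [1/8 + (255/4) e^2 E N].  Averaging over [i] with [e = sqrt (K / Rb) / 24]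
    shows that a uniformly random bumped arm is pulled at most [3/4 Rb] times on
    average; Fubini restores the seed. *)

Set Implicit Arguments.
Unset Strict Implicit.
Unset Printing Implicit Defensive.

Import Order.TTheory GRing.Theory Num.Theory.

Local Open Scope classical_set_scope.
Local Open Scope ring_scope.

(** * Bernoulli reward tables and expectations along a history *)

Definition table (T K : nat) := {ffun 'I_T * 'I_K -> bool}.

HB.instance Definition _ T K := Finite.on (table T K).
HB.instance Definition _ T K := isPointed.Build (table T K) [ffun=> false].
HB.instance Definition _ T K := @isMeasurable.Build default_measure_display
  (table T K) discrete_measurable discrete_measurable0
  discrete_measurableC discrete_measurableU.

Section table.
Variables (R : realType) (T K : nat).
Implicit Types (mu : 'I_K -> R) (w : table T K) (h : seq ('I_K * R)).

Definition bern (m : R) (b : bool) : R := if b then m else 1 - m.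

Lemma bern_ge0 m b : 0 <= m <= 1 -> 0 <= bern m b.
Proof. by case/andP => *; case: b; rewrite /bern ?subr_ge0. Qed.

Lemma sum_bern m : \sum_b bern m b = 1.
Proof. by rewrite big_bool /= addrC subrK. Qed.

Definition table_mass mu w : R := \prod_c bern (mu c.2) (w c).

Lemma table_mass_ge0 mu w : (forall i, 0 <= mu i <= 1) -> 0 <= table_mass mu w.
Proof. by move=> mu01; apply: prodr_ge0 => c _; exact: bern_ge0. Qed.

(** Distributivity of the product over the sum; this is the source of the independence of the
    cells. *)
Lemma sum_table_mass_prod mu (g : 'I_T * 'I_K -> bool -> R) :
  \sum_w table_mass mu w * \prod_c g c (w c) =
  \prod_c \sum_b bern (mu c.2) b * g c b.
Proof.
by rewrite bigA_distr_bigA; apply: eq_bigr => w _; rewrite big_split.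
Qed.

Lemma sum_table_mass mu : \sum_w table_mass mu w = 1.
Proof.
rewrite -(bigA_distr_bigA (fun c b => bern (mu c.2) b)) big1// => c _.
exact: sum_bern.
Qed.

Definition flip (c : 'I_T * 'I_K) w : table T K :=
  [ffun d => if d == c then ~~ w d else w d].

Lemma flipK c : involutive (flip c).
Proof.
by move=> w; apply/ffunP => d; rewrite !ffunE; case: eqP; rewrite ?negbK.
Qed.

(* Pair each table with its flip at [c w]: the two masses differ only in the
   factor of the cell [c w]. *)
Lemma sum_table_resample mu (c : table T K -> 'I_T * 'I_K)
    (g : table T K -> bool -> R) :
    (forall w, c (flip (c w) w) = c w) ->
    (forall w b, g (flip (c w) w) b = g w b) ->
  \sum_w table_mass mu w * g w (w (c w)) =
  \sum_w table_mass mu w * \sum_b bern (mu (c w).2) b * g w b.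
Proof.
move=> cflip gflip.
have flip_inv : involutive (fun w => flip (c w) w).
  by move=> w; rewrite cflip flipK.
have symm (G : table T K -> R) :
    \sum_w G w = 2^-1 * \sum_w (G w + G (flip (c w) w)).
  rewrite big_split /= [X in _ + X](_ : _ = \sum_w G w); first by field.
  by rewrite [RHS](reindex_inj (inv_inj flip_inv)).
rewrite symm [RHS]symm; congr (_ * _); apply: eq_bigr => w _.
have massE w' : table_mass mu w' = bern (mu (c w).2) (w' (c w)) *
    \prod_(d | d != c w) bern (mu d.2) (w' d).
  by rewrite /table_mass (bigD1 (c w)).
have flip_rest : \prod_(d | d != c w) bern (mu d.2) (flip (c w) w d) =
    \prod_(d | d != c w) bern (mu d.2) (w d).
  by apply: eq_bigr => d /negPf dc; rewrite ffunE dc.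
rewrite !massE flip_rest cflip !ffunE eqxx !big_bool /= !gflip.
by case: (w (c w)) => /=; ring.
Qed.

(* The value 0 beyond round [T] is irrelevant: a [bandit] constrains only the
   rounds before the horizon. *)
Definition table_reward (t : nat) (i : 'I_K) w : R :=
  if insub t is Some s then (w (s, i))%:R else 0.

Lemma table_rewardE w (t : 'I_T) i : table_reward t i w = (w (t, i))%:R.
Proof. by rewrite /table_reward valK. Qed.

Lemma history_ext (f : seq ('I_K * R) -> 'I_K) (x y : nat -> 'I_K -> R) n :
  (forall t i, (t < n)%N -> x t i = y t i) -> history f x n = history f y n.
Proof.
elim: n => //= n IHn xy; rewrite IHn => [|t i tn]; first by rewrite xy.
by rewrite xy// ltnW.
Qed.

Lemma size_history (f : seq ('I_K * R) -> 'I_K) (x : nat -> 'I_K -> R) n :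
  size (history f x n) = n.
Proof. by elim: n => //= n IHn; rewrite size_rcons IHn. Qed.

Variable f : seq ('I_K * R) -> 'I_K.

Definition expect mu (F : seq ('I_K * R) -> R) (n : nat) : R :=
  \sum_w table_mass mu w * F (history f (fun t i => table_reward t i w) n).

(** Conditional mean of [F] after one more round, given the history [h]. *)
Definition step mu (F : seq ('I_K * R) -> R) h : R :=
  \sum_b bern (mu (f h)) b * F (rcons h (f h, b%:R)).

(** Tower property. The cell read in round [n] is selected by the history of the first [n] rounds,
    which ignores row [n], so [sum_table_resample] may redraw it. *)
Lemma expectS mu F n : (n < T)%N ->
  expect mu F n.+1 = expect mu (step mu F) n.
Proof.
move=> nT; pose hist w := history f (fun t i => table_reward t i w) n.
pose c w : 'I_T * 'I_K := (Ordinal nT, f (hist w)).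
have hist_flip w : hist (flip (c w) w) = hist w.
  apply: history_ext => t i tn; rewrite /table_reward.
  case: insubP => // s _ st; rewrite ffunE xpair_eqE -val_eqE /= st.
  by rewrite ltn_eqF.
rewrite /expect /step /= (eq_bigr (fun w => table_mass mu w *
    F (rcons (hist w) (f (hist w), (w (c w))%:R)))) => [|w _]; last first.
  by rewrite -(table_rewardE w (Ordinal nT)).
rewrite (@sum_table_resample mu c
  (fun w b => F (rcons (hist w) (f (hist w), b%:R)))) //.
- by move=> w; rewrite /c hist_flip.
- by move=> w b; rewrite hist_flip.
Qed.

Lemma expectD mu F G n :
  expect mu (fun h => F h + G h) n = expect mu F n + expect mu G n.
Proof.
by rewrite /expect -big_split; apply: eq_bigr => w _; rewrite mulrDr.
Qed.

Lemma expectZ mu a F n : expect mu (fun h => a * F h) n = a * expect mu F n.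
Proof. by rewrite /expect mulr_sumr; apply: eq_bigr => w _; rewrite mulrCA. Qed.

Lemma expect_cst mu a n : expect mu (fun=> a) n = a.
Proof. by rewrite /expect -mulr_suml sum_table_mass mul1r. Qed.

Lemma expect_le mu F G n : (forall i, 0 <= mu i <= 1) ->
    (forall h, size h = n -> F h <= G h) -> expect mu F n <= expect mu G n.
Proof.
move=> mu01 FG; apply: ler_sum => w _; apply: ler_wpM2l.
  exact: table_mass_ge0.
by apply: FG; exact: size_history.
Qed.

Lemma eq_expect mu F G n : F =1 G -> expect mu F n = expect mu G n.
Proof. by move=> FG; apply: eq_bigr => w _; rewrite FG. Qed.

End table.

(** * Change of measure for a deterministic policy *)

Section lower_bound.
Variables (R : realType) (T K : nat) (f : seq ('I_K * R) -> 'I_K).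
Variable e : R.
Hypotheses (e_ge0 : 0 <= e) (e_le : e <= 4^-1).
Implicit Types (h : seq ('I_K * R)) (i : 'I_K).

Definition flat_means : 'I_K -> R := fun=> 2^-1.
Definition bumped_means i : 'I_K -> R := fun j => 2^-1 + e *+ (j == i).

Lemma flat_means01 j : 0 <= flat_means j <= 1.
Proof. by rewrite /flat_means; lra. Qed.

Lemma bumped_means01 i j : 0 <= bumped_means i j <= 1.
Proof.
move: e_ge0 e_le => ? ?; rewrite /bumped_means; case: (j == i) => /=; lra.
Qed.

Definition arm_count i h : R := \sum_(ax <- h) (ax.1 == i)%:R.

(** A pull of arm [i] multiplies the likelihood ratio by [(1/2 + e) / (1/2)] on reward 1 and by
    [(1/2 - e) / (1/2)] on reward 0; [incr] is this factor minus 1. *)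
Definition incr i (ax : 'I_K * R) : R :=
  (ax.1 == i)%:R * (2 * e * (if ax.2 == 1 then 1 else -1)).

Definition likelihood i h : R := \prod_(ax <- h) (1 + incr i ax).

(** The term [y - 2 y^2] stands in for [ln (1 + y)]: it is a lower bound whose flat mean is an exact
    polynomial in [e]. *)
Definition log_minorant i h : R :=
  \sum_(ax <- h) (incr i ax - 2 * incr i ax ^+ 2).

Local Notation E mu := (@expect R T K f mu).

(** Induction on the last round with [F] general: weighting the flat probability of a reward by
    [1 + incr] gives its bumped probability. *)
Lemma change_of_measure i F n : (n <= T)%N ->
  E (bumped_means i) F n = E flat_means (fun h => likelihood i h * F h) n.
Proof.
elim: n F => [|n IHn] F nT.
  rewrite /expect /= /likelihood big_nil -!mulr_suml !sum_table_mass.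
  by rewrite !mul1r.
rewrite !expectS// IHn 1?ltnW//; apply: eq_expect => h.
rewrite /step !big_bool /likelihood /= !big_rcons /= /incr /=.
rewrite eqxx (eq_sym 0) oner_eq0.
by rewrite /bumped_means /flat_means; case: (f h == i) => /=; field.
Qed.

(** On a pull of [i], [incr] has flat mean 0 and square [4 e^2], so each such pull costs [8 e^2] on
    average; the compensated sum is a martingale started at 0. *)
Lemma expect_log_minorant i n : (n <= T)%N ->
  E flat_means (log_minorant i) n =
  - (8 * e ^+ 2) * E flat_means (arm_count i) n.
Proof.
move=> nT; suff: E flat_means
    (fun h => log_minorant i h + 8 * e ^+ 2 * arm_count i h) n = 0.
  by rewrite expectD expectZ => /eqP; rewrite addr_eq0 mulNr => /eqP.
elim: n nT => [|n IHn] nT.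
  rewrite /expect /= /log_minorant /arm_count !big_nil.
  by rewrite mulr0 addr0 -mulr_suml mulr0.
rewrite expectS// -[RHS]IHn 1?ltnW//; apply: eq_expect => h.
rewrite /step big_bool /log_minorant /arm_count /= !big_rcons /=.
rewrite /= /incr /= eqxx (eq_sym 0) oner_eq0 /flat_means.
by case: (f h == i) => /=; field.
Qed.

Lemma expect_likelihood i n : (n <= T)%N -> E flat_means (likelihood i) n = 1.
Proof.
move=> nT; rewrite -(expect_cst T f (bumped_means i) 1 n) change_of_measure//.
by apply: eq_expect => h; rewrite mulr1.
Qed.

(** By [exp x >= 1 + x] at [x = 2 y^2 - y], it suffices that [(1 + y) (1 - y + 2 y^2) = 1 + y^2 (1 +
    2 y)] is at least 1. *)
Lemma expR_le_1D (y : R) : - 2^-1 <= y -> expR (y - 2 * y ^+ 2) <= 1 + y.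
Proof.
move=> y_ge.
have y1 : 0 < 1 + y by lra.
have z_gt0 : 0 < 1 + (2 * y ^+ 2 - y) by have := sqr_ge0 (y - 4^-1); nra.
rewrite -opprB expRN -(invrK (1 + y)) lef_pV2 ?posrE ?expR_gt0 ?invr_gt0//.
apply: le_trans (expR_ge1Dx _).
rewrite -[leLHS]mul1r ler_pdivrMr//.
have : 0 <= y ^+ 2 * (1 + 2 * y) by apply: mulr_ge0; [exact: sqr_ge0|lra].
lra.
Qed.

Lemma expR_log_minorant i h : expR (log_minorant i h) <= likelihood i h.
Proof.
rewrite /log_minorant /likelihood; elim/big_rec2: _ => [|ax L s _ le_sL].
  by rewrite expR0.
rewrite expRD ler_pM ?expR_ge0//; apply: expR_le_1D.
move: e_ge0 e_le => ? ?; rewrite /incr; case: (_ == i); case: ifP => _ /=; lra.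
Qed.

(* The numbers come from k + 1/(4k) and k - 1/(4k) with k = 8: weighted AM-GM
   bounds [L - 1 = (sqrt L - 1) (sqrt L + 1)] by
   [k (sqrt L - 1)^2 + (sqrt L + 1)^2 / (4k)], where [sqrt L >= 1 + s/2]. *)
Definition tilt i h : R :=
  257 / 32 * (likelihood i h + 1) - 255 / 16 * (1 + log_minorant i h / 2).

Lemma tilt_ge i h : likelihood i h - 1 <= tilt i h /\ 0 <= tilt i h.
Proof.
rewrite /tilt; have := expR_log_minorant i h.
move: (likelihood i h) (log_minorant i h) => L s.
have -> : expR s = expR (s / 2) ^+ 2.
  by rewrite expr2 -expRD; congr expR; field.
have := expR_ge1Dx (s / 2); move: (expR (s / 2)) => r le_sr le_rL.
(* Since [L >= r^2] and [1 + s/2 <= r], the tilt exceeds [L - 1] by at least [(15 r - 17)^2 / 32],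
   and is itself at least [255 (r - 1)^2 / 32]. *)
have : 0 <= (15 * r - 17) ^+ 2 by exact: sqr_ge0.
have : 0 <= (r - 1) ^+ 2 by exact: sqr_ge0.
by split; nra.
Qed.

(** The likelihood has flat mean 1, so the constants leave [257/16 - 255/16 = 1/8]. *)
Lemma expect_tilt i n : (n <= T)%N -> E flat_means (tilt i) n =
  8^-1 + 255 / 4 * e ^+ 2 * E flat_means (arm_count i) n.
Proof.
move=> nT.
rewrite (@eq_expect R T K f flat_means _ (fun h => 257 / 32 * likelihood i h +
   ((257 / 32 - 255 / 16) + (- (255 / 32)) * log_minorant i h))); last first.
  by move=> h; rewrite /tilt; field.
rewrite !expectD !expectZ !expect_cst expect_likelihood// expect_log_minorant//.
by field.
Qed.

Lemma arm_count_itv i h : 0 <= arm_count i h <= (size h)%:R.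
Proof.
rewrite /arm_count sumr_ge0 => [|? _]; last by rewrite ler0n.
rewrite -sum1_size natr_sum; apply: ler_sum => ax _.
by rewrite lern1; case: (_ == _).
Qed.

Lemma sum_arm_count h : \sum_i arm_count i h = (size h)%:R.
Proof.
rewrite exchange_big /= -sum1_size natr_sum; apply: eq_bigr => ax _.
rewrite (bigD1 ax.1)//= eqxx big1 ?addr0// => i.
by rewrite eq_sym => /negPf ->.
Qed.

(** As the count [N] lies in [[0, n]], pointwise [(L - 1) N <= tilt N <= n tilt]. *)
Lemma expect_bumped_arm_count i n : (n <= T)%N ->
  E (bumped_means i) (arm_count i) n <=
  n%:R / 8 + (1 + 255 / 4 * e ^+ 2 * n%:R) * E flat_means (arm_count i) n.
Proof.
move=> nT; rewrite change_of_measure//.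
apply: (@le_trans _ _
    (E flat_means (fun h => arm_count i h + n%:R * tilt i h) n)).
  apply: expect_le => [|h <-]; first exact: flat_means01.
  have [tilt_geL tilt_ge0] := tilt_ge i h.
  have /andP[count_ge0 count_le] := arm_count_itv i h.
  by nra.
by rewrite expectD expectZ expect_tilt//; lra.
Qed.

Lemma sum_expect_arm_count n :
  \sum_i E flat_means (arm_count i) n = n%:R.
Proof.
rewrite -[RHS](expect_cst T f flat_means _ n) exchange_big.
by apply: eq_bigr => w _; rewrite -mulr_sumr sum_arm_count size_history.
Qed.

(** The flat counts sum to [n], so the total is at most [K n / 8 + n + (255/4) e^2 n^2]. Here
    [n <= K n / 2] because [K >= 2], and the last term is at most [K n / 9]. *)
Lemma sum_expect_bumped_arm_count n : (n <= T)%N -> (2 <= K)%N ->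
    576 * e ^+ 2 * n%:R <= K%:R ->
  \sum_i E (bumped_means i) (arm_count i) n <= 3 / 4 * K%:R * n%:R.
Proof.
move=> nT K2 eK.
apply: le_trans (ler_sum _ (fun i _ => expect_bumped_arm_count i nT)) _.
rewrite big_split /= sumr_const card_ord -mulr_sumr sum_expect_arm_count.
rewrite -mulr_natr.
have K2' : 2 <= K%:R :> R by rewrite (ler_nat _ 2).
have n_ge0 : 0 <= n%:R :> R by [].
have : 576 * e ^+ 2 * n%:R * n%:R <= K%:R * n%:R by exact: ler_wpM2r.
have : 2 * n%:R <= K%:R * n%:R :> R by exact: ler_wpM2r.
have : 0 <= e ^+ 2 * n%:R * n%:R by rewrite !mulr_ge0 ?sqr_ge0.
lra.
Qed.

End lower_bound.

(** * The table law as a probability measure, and its bandit *)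

Section table_law.
Variables (R : realType) (T K : nat) (mu : 'I_K -> R).
Hypothesis mu01 : forall i, 0 <= mu i <= 1.

(** [msum] takes a sequence of measures, hence an enumeration of the tables: the law is a finite sum
    of weighted Dirac masses. *)
Let nth_table (k : nat) : table T K := nth point (enum (table T K)) k.

Let point_mass (k : nat) : {measure set (table T K) -> \bar R} :=
  mscale (NngNum (table_mass_ge0 (nth_table k) mu01)) \d_(nth_table k).

Definition table_law : set (table T K) -> \bar R :=
  msum point_mass #|table T K|.

HB.instance Definition _ := Measure.on table_law.

Let sum_nth_table (F : table T K -> \bar R) :
  (\sum_(k < #|table T K|) F (nth_table k) = \sum_w F w)%E.
Proof.
by rewrite -[RHS]big_enum (big_nth point) big_mkord -cardT.
Qed.

Lemma table_lawE A :
  table_law A = (\sum_w (table_mass mu w * (w \in A)%:R))%:E.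
Proof.
rewrite /table_law /msum /=.
rewrite (sum_nth_table (fun w => ((table_mass mu w)%:E * \d_w A)%E)).
rewrite -sumEFin.
by apply: eq_bigr => w _; rewrite EFinM diracE.
Qed.

Let table_lawT : table_law setT = 1%E.
Proof.
rewrite table_lawE -[1%E]/((1 : R)%:E) -[RHS](congr1 _ (sum_table_mass T mu)).
by congr EFin; apply: eq_bigr => w _; rewrite in_setT mulr1.
Qed.

HB.instance Definition _ :=
  @Measure_isProbability.Build _ _ _ table_law table_lawT.

Lemma ge0_integral_table_law (F : table T K -> \bar R) :
    (forall w, 0 <= F w)%E ->
  (\int[table_law]_w F w = \sum_w (table_mass mu w)%:E * F w)%E.
Proof.
move=> F0; have mF : measurable_fun [set: table T K] F by [].
rewrite ge0_integral_measure_sum//.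
rewrite -(sum_nth_table (fun w => ((table_mass mu w)%:E * F w)%E)).
apply: eq_bigr => k _; rewrite ge0_integral_mscale//=.
by rewrite integral_dirac// diracT mul1e.
Qed.

Lemma sum_table_mass_coord (c : 'I_T * 'I_K) (g : bool -> R) :
  \sum_w table_mass mu w * g (w c) = \sum_b bern (mu c.2) b * g b.
Proof.
rewrite (@sum_table_resample R T K mu (fun=> c) (fun=> g))//.
by rewrite -mulr_suml sum_table_mass mul1r.
Qed.

(** Independence of the cells. A cell outside [J] has a vacuous constraint and its factor sums to 1,
    so the product may run over all cells. *)
Lemma table_law_coords (J : {set 'I_T * 'I_K}) (B : 'I_T * 'I_K -> set bool) :
  table_law [set w | forall c, c \in J -> B c (w c)] =
  (\prod_(c in J) \sum_b bern (mu c.2) b * (b \in B c)%:R)%:E.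
Proof.
rewrite table_lawE [in RHS]big_mkcond /=; congr EFin.
have -> : \prod_c (if c \in J then \sum_b bern (mu c.2) b * (b \in B c)%:R
    else 1) =
    \prod_c \sum_b bern (mu c.2) b * ((c \in J) ==> (b \in B c))%:R :> R.
  apply: eq_bigr => c _; case: (c \in J) => //=.
  transitivity (\sum_b bern (mu c.2) b); first by rewrite sum_bern.
  by apply: eq_bigr => b _; rewrite mulr1.
rewrite -(sum_table_mass_prod mu
  (fun c b => ((c \in J) ==> (b \in B c))%:R)).
apply: eq_bigr => w _; congr (_ * _).
have [wJ|/existsNP[c /not_implyP[cJ ncB]]] :=
    pselect (forall c, c \in J -> B c (w c)).
  rewrite mem_set// big1// => c _.
  by case: (boolP (c \in J)) => [/wJ/mem_set ->|].
rewrite memNset => [|/(_ c cJ)//].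
by rewrite (bigD1 c)//= cJ memNset ?mul0r.
Qed.

Lemma table_law_coord (c : 'I_T * 'I_K) (B : set bool) :
  table_law [set w | B (w c)] =
  (\sum_b bern (mu c.2) b * (b \in B)%:R)%:E.
Proof.
have := table_law_coords [set c]%SET (fun=> B); rewrite big_set1 => <-.
congr table_law; apply/seteqP; split => w /= wB; last first.
  by apply: wB; rewrite set11.
by move=> d; rewrite inE => /eqP ->.
Qed.

HB.instance Definition _ (t : nat) (i : 'I_K) :=
  @isMeasurableFun.Build _ _ (table T K) R
    (@table_reward R T K t i) (fun _ _ _ => I).

Definition table_rv (t : nat) (i : 'I_K) : {RV table_law >-> R} :=
  (@table_reward R T K t i : {mfun table T K >-> R}).

Let table_rv_itv t i w : 0 <= table_rv t i w <= 1.
Proof.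
rewrite /table_rv /= /table_reward; case: insubP => [s _ _|_].
  by case: (w _); rewrite !lexx ler01.
by rewrite lexx ler01.
Qed.

Let table_rvE t i (tT : (t < T)%N) w :
  table_rv t i w = (w (Ordinal tT, i))%:R.
Proof. exact: (table_rewardE _ _ (Ordinal tT)). Qed.

Let table_rv_mean t i : (t < T)%N -> ('E_table_law[table_rv t i] = (mu i)%:E)%E.
Proof.
move=> tT; rewrite unlock ge0_integral_table_law => [|w]; last first.
  by rewrite lee_fin; case/andP: (table_rv_itv t i w).
under eq_bigr do rewrite table_rvE -EFinM.
rewrite sumEFin (sum_table_mass_coord (Ordinal tT, i) (fun b => b%:R)).
by rewrite big_bool /= mulr1 mulr0 addr0.
Qed.

Let table_rv_law t i (B : set R) : (t < T)%N ->
  distribution table_law (table_rv t i) B =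
  (\sum_b bern (mu i) b * (b \in [set b : bool | B b%:R])%:R)%:E.
Proof.
move=> tT; rewrite -(table_law_coord (Ordinal tT, i)).
rewrite /distribution /pushforward.
by congr table_law; apply/seteqP; split => w /=; rewrite table_rvE.
Qed.

Let table_rv_ident s t i (B : set (measurableTypeR R)) :
    (s < T)%N -> (t < T)%N -> measurable B ->
  distribution table_law (table_rv s i) B =
  distribution table_law (table_rv t i) B.
Proof. by move=> sT tT _; rewrite !table_rv_law. Qed.

Let table_rv_indep : mutually_independent
  (fun ti : 'I_T * 'I_K => table_rv ti.1 ti.2).
Proof.
move=> J B _.
rewrite (_ : [set w | _] = [set w : table T K | forall c, c \in J ->
    [set b : bool | B c b%:R] (w c)]); last first.
  apply/seteqP; split => w /= wJ [t i] /wJ.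
    by rewrite /table_rv /= table_rewardE.
  by rewrite /table_rv /= table_rewardE.
rewrite [LHS](table_law_coords J (fun c => [set b : bool | B c b%:R])).
rewrite -prodEFin; apply: eq_bigr => c _.
by rewrite -(table_rv_law c.2 (B c) (ltn_ord c.1)).
Qed.

Definition table_bandit : bandit T mu :=
  Bandit table_rv_itv table_rv_mean table_rv_ident table_rv_indep.

End table_law.

(** * Measurability in the seed, and integration over table and seed *)

Lemma measurable_fun_fin_valued (R : realType) d (U : measurableType d)
    (I : finType) (X : U -> I) (g : I -> R) :
    (forall i, measurable [set u | X u = i]) ->
  measurable_fun setT (fun u => g (X u)).
Proof.
move=> mX _ B mB; rewrite setTI.
rewrite (_ : _ @^-1` B = \bigcup_(i in [set i | B (g i)]) [set u | X u = i]).
  by apply: fin_bigcup_measurable => //; exact: finite_finset.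
by apply/seteqP; split => [u gXu|u [i gi /= ->]] //; exists (X u).
Qed.

(** There are finitely many tables, so a preimage is a finite union of rectangles. *)
Lemma measurable_table_prod (R : realType) T K d (U : measurableType d)
    (F : table T K * U -> R) :
    (forall w, measurable_fun setT (fun u => F (w, u))) ->
  measurable_fun setT F.
Proof.
move=> mF _ B mB; rewrite setTI.
rewrite (_ : F @^-1` B =
  \bigcup_(w in [set: table T K]) ([set w] `*` [set u | B (F (w, u))])).
  apply: fin_bigcup_measurable => [|w _]; first exact: finite_finset.
  by apply: measurableX => //; rewrite -[X in measurable X]setTI; exact: mF.
by apply/seteqP; split => [[w u] ? | [w u] [v _ [/= ->]]] //; exists w.
Qed.

Section policy.
Variables (R : realType) (K : nat) (pi : policy R K).

(** A section, at the rewards of [h], of the set that [act_measurable] makes jointly measurable. *)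
Lemma measurable_act (h : seq ('I_K * R)) (i : 'I_K) :
  measurable [set u | act (p := pi) u h = i].
Proof.
have := measurable_ysection
  (map_tuple snd (in_tuple h) : (size h).-tuple (measurableTypeR R))
  (@act_measurable _ _ pi _ (map_tuple fst (in_tuple h)) i).
by rewrite ysectionE /preimage /= zip_unzip.
Qed.

(** [A] must depend on the seed too: unrolling the last round yields a predicate that involves
    [act u h]. *)
Lemma measurable_history (x : nat -> 'I_K -> R)
    (A : seed pi -> seq ('I_K * R) -> Prop) (t : nat) :
    (forall h, measurable [set u | A u h]) ->
  measurable [set u | A u (history (act u) x t)].
Proof.
elim: t A => [|t IHt] A mA //=.
apply: (IHt (fun u h => A u (rcons h (act u h, x t (act u h))))) => h.
rewrite (_ : [set u | _] = \bigcup_(a in [set: 'I_K])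
    ([set u | act u h = a] `&` [set u | A u (rcons h (a, x t a))])).
  apply: fin_bigcup_measurable => [|a _]; first exact: finite_finset.
  by apply: measurableI => //; exact: measurable_act.
by apply/seteqP; split => [u Au|u [a _ [/= ->]]] //; exists (act u h).
Qed.

Lemma measurable_fun_arm (x : nat -> 'I_K -> R) (g : 'I_K -> R) (t : nat) :
  measurable_fun setT (fun u : seed pi => g (act u (history (act u) x t))).
Proof.
apply: measurable_fun_fin_valued => i.
apply: (@measurable_history x (fun u h => act u h = i)) => h.
exact: measurable_act.
Qed.

End policy.

Section joint.
Variables (R : realType) (T K : nat) (pi : policy R K) (mu : 'I_K -> R).
Hypothesis mu01 : forall i, 0 <= mu i <= 1.

(** Tonelli with the table integrated first, so that the seed is frozen inside the sum. *)
Lemma ge0_integral_joint_law (F : table T K * seed pi -> R) :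
    (forall z, 0 <= F z) ->
    (forall w, measurable_fun setT (fun u => F (w, u))) ->
  (\int[joint_law pi (table_bandit T mu01)]_z (F z)%:E =
   \int[seed_law pi]_u (\sum_w table_mass mu w * F (w, u))%:E)%E.
Proof.
move=> F0 mF.
rewrite /joint_law fubini_tonelli2 => [||]; last first.
- by move=> z; rewrite lee_fin.
- by apply/measurable_EFinP; exact: measurable_table_prod.
apply: eq_integral => u _; rewrite /fubini_G.
rewrite ge0_integral_table_law => [|w]; last by rewrite lee_fin.
by rewrite -sumEFin.
Qed.

Lemma arm_countE (f : seq ('I_K * R) -> 'I_K) (x : nat -> 'I_K -> R) i n :
  arm_count i (history f x n) = \sum_(0 <= t < n) (f (history f x t) == i)%:R.
Proof.
elim: n => [|n IHn]; first by rewrite /arm_count big_nil big_geq.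
by rewrite big_nat_recr//= -IHn /arm_count big_rcons.
Qed.

End joint.

(** * The instance with forced rounds *)

Section forced_instance.
Variables (K n M : nat) (a0 : 'I_K).
Hypothesis n_gt0 : (0 < n)%N.

Definition forced_len (b : 'I_M.+1) : nat := if val b == 0%N then n else 1%N.

Definition forced_floor (b : 'I_M.+1) (i : 'I_K) : nat :=
  if val b == 0%N then 0%N else i == a0.

Lemma forced_len_gt0 b : (0 < forced_len b)%N.
Proof. by rewrite /forced_len; case: ifP. Qed.

Lemma sum_forced_floor b :
  (\sum_i forced_floor b i)%N = (if val b == 0%N then 0%N else 1%N).
Proof.
rewrite /forced_floor; case: ifP => _; first by rewrite big1.
by rewrite (bigD1 a0)//= eqxx big1 ?addn0// => i /negPf ->.
Qed.

Lemma forced_floor_le b : (\sum_i forced_floor b i <= forced_len b)%N.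
Proof. by rewrite sum_forced_floor /forced_len; case: ifP. Qed.

Definition forced_instance : instance K :=
  Instance forced_len_gt0 forced_floor_le.

Lemma horizon_forced : horizon forced_instance = (n + M)%N.
Proof.
rewrite /horizon /= big_ord_recl /forced_len /=; congr addn.
by rewrite sum1_card card_ord.
Qed.

Lemma total_mandatory_forced : total_mandatory forced_instance = M.
Proof.
rewrite /total_mandatory /=; under eq_bigr do rewrite sum_forced_floor.
by rewrite big_ord_recl /= add0n sum1_card card_ord.
Qed.

Lemma total_residual_forced : total_residual forced_instance = n.
Proof.
rewrite /total_residual /=; under eq_bigr do rewrite sum_forced_floor.
by rewrite big_ord_recl /forced_len /= subn0 big1 ?addn0.
Qed.

Lemma block_start_forced (k : 'I_M) :
  block_start (I := forced_instance) (lift ord0 k) = (n + k)%N.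
Proof.
rewrite /block_start /= big_mkcond big_ord_recl /forced_len /=; congr addn.
rewrite -big_mkcond (eq_bigl (fun j : 'I_M => (j < k)%N)) => [|j]; last first.
  by rewrite /= ltnS.
by rewrite (big_ord_narrow (ltnW (ltn_ord k))) sum1_card card_ord.
Qed.

Variable R : realType.

(** If [a0] is [istar], the benchmark leaves out its floors, but then its gap is 0; in both cases
    the penalty is [M] times the gap of [a0]. *)
Lemma opt_forced (mu : 'I_K -> R) istar : best_arm mu istar ->
  opt forced_instance mu istar = n%:R * mean_star mu + M%:R * mu a0.
Proof.
move=> best; have gap0 : gap mu istar = 0 by rewrite /gap best subrr.
suff floorE : \sum_(b < M.+1) \sum_(i < K | i != istar)
    (forced_floor b i)%:R * gap mu i = M%:R * gap mu a0.
  by rewrite /opt horizon_forced /= floorE /gap natrD; ring.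
rewrite big_ord_recl big1 ?add0r => [|i _]; last by rewrite /forced_floor mul0r.
rewrite (eq_bigr (fun=> gap mu a0)) => [|b _].
  by rewrite sumr_const card_ord mulr_natl.
rewrite /forced_floor /=.
have [a0i|a0i] := eqVneq a0 istar.
  by rewrite a0i gap0 big1// => i /negPf ->; rewrite mul0r.
rewrite (bigD1 a0)//= eqxx mul1r big1 ?addr0// => i /andP[_ /negPf ->].
by rewrite mul0r.
Qed.

Section fair.
Variables (pi : policy R K) (T : nat) (mu : 'I_K -> R) (nu : bandit T mu).

(** Round [n + k] is the only round of block [k + 1], whose floor on [a0] is 1. *)
Lemma fair_arm (z : bd_space nu * seed pi) (k : nat) : (k < M)%N ->
    (forall b i, (floor_ b i <= pulls (I := forced_instance) b i z)%N) ->
  arm (n + k) z = a0.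
Proof.
move=> kM /(_ (lift ord0 (Ordinal kM)) a0).
rewrite /pulls block_start_forced /= /forced_floor /forced_len /= eqxx addn1.
by rewrite big_nat1; case: eqP.
Qed.

Lemma fair_total_reward (z : bd_space nu * seed pi) :
    (forall b i, (floor_ b i <= pulls (I := forced_instance) b i z)%N) ->
  \sum_(0 <= t < horizon forced_instance) mu (arm t z) =
  \sum_(0 <= t < n) mu (arm t z) + M%:R * mu a0.
Proof.
move=> fair; rewrite horizon_forced (big_cat_nat (n := n))//= ?leq_addr//.
congr (_ + _); rewrite -{1}[n]add0n big_addn addKn.
rewrite (eq_big_nat _ _ (F2 := fun=> mu a0)) => [|k /andP[_ kM]].
  by rewrite sumr_const_nat subn0 mulr_natl.
by rewrite addnC fair_arm.
Qed.

End fair.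
End forced_instance.

(** * Regret on the bumped bandits, averaged over the bumped arm *)

Section bumped.
Variables (R : realType) (K : nat) (e : R).
Hypotheses (e_ge0 : 0 <= e) (e_le : e <= 4^-1).

Lemma mean_star_bumped i : mean_star (bumped_means (K := K) e i) = 2^-1 + e.
Proof.
rewrite /mean_star; apply/eqP; rewrite eq_le; apply/andP; split.
  apply/bigmax_leP; split => [|j _]; first by rewrite addr_ge0.
  by rewrite /bumped_means lerD2l; case: (j == i).
by apply: le_trans (le_bigmax _ _ i); rewrite /bumped_means eqxx.
Qed.

Lemma best_arm_bumped i : best_arm (bumped_means (K := K) e i) i.
Proof. by rewrite /best_arm mean_star_bumped /bumped_means eqxx. Qed.

Variables (n M : nat) (a0 : 'I_K) (n_gt0 : (0 < n)%N) (pi : policy R K).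

Let I := forced_instance M a0 n_gt0.
Let T := horizon I.
Let nT : (n <= T)%N. Proof. by rewrite /T horizon_forced leq_addr. Qed.

Hypothesis fair : blockwise_fair I pi.

Definition bumped_bandit (i : 'I_K) : bandit T (bumped_means e i) :=
  table_bandit T (bumped_means01 e_ge0 e_le i).

Definition mean_arm_count (i : 'I_K) (u : seed pi) : R :=
  expect T (act u) (bumped_means e i) (arm_count i) n.

Lemma measurable_arm_count (i : 'I_K) (w : table T K) : measurable_fun setT
  (fun u : seed pi =>
    arm_count i (history (act u) (fun t j => table_reward R t j w) n)).
Proof.
under eq_fun do rewrite arm_countE.
apply: measurable_sum => t.
exact: (measurable_fun_arm _ (fun j => (j == i)%:R)).
Qed.

Lemma measurable_mean_arm_count i : measurable_fun setT (mean_arm_count i).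
Proof.
apply: measurable_sum => w; apply: measurable_funM => //.
exact: measurable_arm_count.
Qed.

Lemma mean_arm_count_itv i u : 0 <= mean_arm_count i u <= n%:R.
Proof.
rewrite -{1}(expect_cst T (act u) (bumped_means e i) 0 n).
rewrite -(expect_cst T (act u) (bumped_means e i) n%:R n).
apply/andP; split; apply: expect_le => [|h sz_h]; do ?exact: bumped_means01.
  by have /andP[] := arm_count_itv i h.
by have /andP[] := arm_count_itv i h; rewrite sz_h.
Qed.

Definition exp_arm_count i : \bar R :=
  (\int[seed_law pi]_u (mean_arm_count i u)%:E)%E.

Lemma exp_arm_count_fin i : exp_arm_count i \is a fin_num.
Proof.
rewrite ge0_fin_numE; last first.
  apply: integral_ge0 => u _; rewrite lee_fin.
  by case/andP: (mean_arm_count_itv i u).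
apply: (@le_lt_trans _ _ (\int[seed_law pi]_u (cst (n%:R%:E) u))%E).
  apply: ge0_le_integral => //.
  - by move=> u _; rewrite lee_fin; case/andP: (mean_arm_count_itv i u).
  - by apply/measurable_EFinP; exact: measurable_mean_arm_count.
  - by move=> u _; rewrite lee_fin; case/andP: (mean_arm_count_itv i u).
by rewrite integral_cst//= probability_setT mule1 ltry.
Qed.

Lemma sum_exp_arm_count : (2 <= K)%N -> 576 * e ^+ 2 * n%:R <= K%:R ->
  \sum_i fine (exp_arm_count i) <= 3 / 4 * K%:R * n%:R.
Proof.
move=> K2 eK; rewrite -lee_fin -sumEFin.
under eq_bigr do rewrite fineK ?exp_arm_count_fin//.
rewrite /exp_arm_count -ge0_integral_sum//; last 2 first.
- by move=> i; apply/measurable_EFinP; exact: measurable_mean_arm_count.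
- by move=> i u _; rewrite lee_fin; case/andP: (mean_arm_count_itv i u).
apply: (@le_trans _ _
    (\int[seed_law pi]_u (cst (3 / 4 * K%:R * n%:R)%:E u))%E).
  apply: ge0_le_integral => //.
  - move=> u _; apply: sume_ge0 => i _.
    by rewrite lee_fin; case/andP: (mean_arm_count_itv i u).
  - apply: emeasurable_sum => i.
    by apply/measurable_EFinP; exact: measurable_mean_arm_count.
  - by move=> u _; rewrite sumEFin lee_fin; exact: sum_expect_bumped_arm_count.
by rewrite integral_cst//= probability_setT mule1.
Qed.

Lemma regret_bumped i : regret I pi (bumped_bandit i) i =
  (e * (n%:R - fine (exp_arm_count i)))%:E.
Proof.
pose mu := bumped_means (K := K) e i.
(* The part of the reward that does not depend on the policy: 1/2 per free round, plus the forced
   pulls. *)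
pose c := 2^-1 * n%:R + M%:R * mu a0.
have c_ge0 : 0 <= c.
  by rewrite addr_ge0 ?mulr_ge0//; case/andP: (bumped_means01 e_ge0 e_le i a0).
pose F (z : table T K * seed pi) : R := \sum_(0 <= t < T)
  mu (act z.2 (history (act z.2) (fun s j => table_reward R s j z.1) t)).
pose G (z : table T K * seed pi) : R := c + e *
  arm_count i (history (act z.2) (fun s j => table_reward R s j z.1) n).
have F_ge0 z : 0 <= F z.
  by apply: sumr_ge0 => t _; case/andP: (bumped_means01 e_ge0 e_le i
    (act z.2 (history (act z.2) (fun s j => table_reward R s j z.1) t))).
have G_ge0 z : 0 <= G z.
  rewrite addr_ge0// mulr_ge0//.
  by case/andP: (arm_count_itv i
    (history (act z.2) (fun s j => table_reward R s j z.1) n)).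
have mG w : measurable_fun setT (fun u => G (w, u)).
  apply: measurable_funD => //; apply: measurable_funM => //.
  exact: measurable_arm_count.
have E_F : ('E_(joint_law pi (bumped_bandit i))[F] =
    c%:E + e%:E * exp_arm_count i)%E.
  rewrite unlock.
  (* Fairness fixes the forced rounds only almost surely, so [F] and [G] agree only almost
     everywhere. *)
  transitivity (\int[joint_law pi (bumped_bandit i)]_z (G z)%:E)%E.
    apply: ge0_ae_eq_integral => //.
    - apply/measurable_EFinP; apply: measurable_table_prod => w.
      apply: measurable_sum => t.
      exact: (measurable_fun_arm (fun s j => table_reward R s j w) mu).
    - by apply/measurable_EFinP; exact: measurable_table_prod.
    - by move=> z _; rewrite lee_fin.
    - by move=> z _; rewrite lee_fin.
    move: (fair (bumped_bandit i)); apply: filterS => z /fair_total_reward Fz _.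
    congr EFin; rewrite /F /G /c Fz arm_countE /bumped_means.
    rewrite big_split /= sumr_const_nat subn0 mulr_sumr mulr_natr.
    rewrite addrAC; congr (_ + _ + _).
    by apply: eq_bigr => t _; rewrite mulr_natr.
  rewrite ge0_integral_joint_law//.
  transitivity (\int[seed_law pi]_u (c%:E + e%:E * (mean_arm_count i u)%:E))%E.
    apply: eq_integral => u _; rewrite -EFinM -EFinD; congr EFin.
    rewrite -expectZ -[in RHS](expect_cst T (act u) mu c n).
    by rewrite -expectD.
  rewrite ge0_integralD//; last 2 first.
  - by move=> u _; rewrite -EFinM lee_fin mulr_ge0//;
      case/andP: (mean_arm_count_itv i u).
  - by apply/measurable_EFinP; apply: measurable_funM => //;
      exact: measurable_mean_arm_count.
  rewrite integral_cst//= probability_setT mule1 ge0_integralZl_EFin//.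
  - by move=> u _; rewrite lee_fin; case/andP: (mean_arm_count_itv i u).
  - by apply/measurable_EFinP; exact: measurable_mean_arm_count.
rewrite /regret (_ : (fun w => _) = F)// E_F.
rewrite (opt_forced M a0 n_gt0 (best_arm_bumped i)).
rewrite mean_star_bumped -[in LHS](fineK (exp_arm_count_fin i)) -EFinM.
rewrite -EFinD; congr EFin; rewrite /c -/mu; ring.
Qed.

Lemma sup_regret_bumped : (2 <= K)%N -> 576 * e ^+ 2 * n%:R <= K%:R ->
  ((e * n%:R / 4)%:E <= sup_regret I pi)%E.
Proof.
move=> K2 eK.
have [i le_i] : exists i, e * n%:R / 4 <= e * (n%:R - fine (exp_arm_count i)).
  (* Otherwise every bumped arm would have mean count above [3/4 n], against the bound on the
     sum. *)
  apply/not_existsP => lt_i.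
  have := sum_exp_arm_count K2 eK; apply/negP; rewrite -ltNge.
  have -> : 3 / 4 * K%:R * n%:R = \sum_(i < K) 3 / 4 * n%:R :> R.
    by rewrite sumr_const card_ord -mulr_natl; ring.
  apply: ltr_sum => [|i _].
    (* A strict inequality of sums needs a nonempty index set, witnessed by [a0]. *)
    by apply/hasP; exists a0 => //; rewrite mem_index_enum.
  rewrite ltNge; apply/negP; rewrite -subr_ge0 => /(mulr_ge0 e_ge0) eN_ge0.
  by apply: (lt_i i); lra.
apply: (@le_trans _ _ (regret I pi (bumped_bandit i) i)).
  by rewrite regret_bumped lee_fin.
apply: ereal_sup_ubound; exists (bumped_means e i), (bumped_bandit i), i.
by split => [j||//]; [exact: bumped_means01|exact: best_arm_bumped].
Qed.

End bumped.

Theorem proposition18 (R : realType) :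
  exists2 c : R, 0 < c &
    forall K Rb M : nat, (2 <= K)%N -> (K <= Rb)%N ->
      exists I : instance K,
        [/\ total_mandatory I = M,
            total_residual I = Rb
          & forall pi : policy R K, blockwise_fair I pi ->
              ((c * Num.sqrt ((K * Rb)%N%:R))%:E <= sup_regret I pi)%E].
Proof.
(* The bound [e Rb / 4] with [e = sqrt (K / Rb) / 24] gives [96 = 4 * 24]. *)
exists (96^-1) => [|K Rb M K2 KRb]; first by lra.
have K_gt0 : (0 < K)%N by exact: leq_trans K2.
have Rb_gt0 : (0 < Rb)%N by exact: leq_trans KRb.
have K_gt0' : 0 < K%:R :> R by rewrite ltr0n.
have Rb_gt0' : 0 < Rb%:R :> R by rewrite ltr0n.
exists (forced_instance M (Ordinal K_gt0) Rb_gt0); split => [||pi fair].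
- exact: total_mandatory_forced.
- exact: total_residual_forced.
pose q : R := Num.sqrt (K%:R / Rb%:R).
have q2 : q ^+ 2 = K%:R / Rb%:R by rewrite sqr_sqrtr// divr_ge0.
have q_ge0 : 0 <= q by exact: sqrtr_ge0.
have q_le1 : q <= 1.
  by rewrite -sqrtr1 ler_wsqrtr// ler_pdivrMr// mul1r ler_nat.
have sqrtE : Num.sqrt (K * Rb)%N%:R = q * Rb%:R :> R.
  rewrite -[in RHS](ger0_norm (ltW Rb_gt0')) -sqrtr_sqr -sqrtrM ?divr_ge0//.
  by congr Num.sqrt; rewrite natrM; field; exact: lt0r_neq0.
(* As [24^2 = 576], this [e] turns the condition [576 e^2 Rb <= K] into an equality; [K <= Rb] keeps
   [e] below 1/4. *)
have e_ge0 : 0 <= q / 24 by lra.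
have e_le : q / 24 <= 4^-1 by lra.
rewrite sqrtE (_ : _ * _ = q / 24 * Rb%:R / 4); last by field.
apply: (sup_regret_bumped e_ge0 e_le fair K2).
rewrite expr_div_n q2 le_eqVlt; apply/orP; left; apply/eqP.
by field; exact: lt0r_neq0.
Qed.
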